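(* Let $(\mathcal{X},d)$ be a finite metric space with at least two points, $\mu\in\mathcal{M}_+(\mathcal{X})$, $t>0$, $s\in(0,1]$, and let $\hat\mu_{t,s}$ be the Poisson-model estimator. Then for every $p\ge1$, $C>0$, $q>1$ and $L\in\mathbb{N}$, $$\mathbb{E}\big[\mathrm{KR}_{p,C}(\hat\mu_{t,s},\mu)\big]\le \mathcal{E}^{\mathrm{Poi}}_{p,\mathcal{X}}(C,q,L)^{1/p}\cdot\begin{cases}\Big(2(1-s)\mathbb{M}(\mu)+\frac{s}{\sqrt t}\sum_{x\in\mathcal{X}}\sqrt{\mu(x)}\Big)^{1/p}, & \text{if } C\le\max\{2h_{q,L}(L),\min_{x\ne x'}d(x,x')\},\\[1ex] \Big(\frac{1}{st}\mathbb{M}(\mu)+\frac{1-s}{s}\sum_{x\in\mathcal{X}}\mu(x)^2\Big)^{1/(2p)}, & \text{otherwise,}\end{cases}$$ where $\mathcal{E}^{\mathrm{Poi}}_{p,\mathcal{X}}(C,q,L)$ is defined in the context. Moreover, for $p=1$ the bound remains valid when the factor $\frac{q}{q-1}$ is removed from $A_{q,1,L,\mathcal{X}}(l)$.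
   Context: $\mathcal{M}_+(\mathcal{X})$, $\mathbb{M}(\mu)=\sum_x\mu(x)$, sub-couplings $\Pi_\le(\mu,\nu)=\{\pi\ge0:\sum_{x'}\pi(x,x')\le\mu(x),\sum_x\pi(x,x')\le\nu(x')\}$ and $\mathrm{KR}_{p,C}(\mu,\nu)=\big(\min_{\pi\in\Pi_\le(\mu,\nu)}\sum_{x,x'}d^p(x,x')\pi(x,x')+C^p(\frac{\mathbb{M}(\mu)+\mathbb{M}(\nu)}{2}-\mathbb{M}(\pi))\big)^{1/p}$. Poisson model: independent $P_x\sim\mathrm{Poi}(t\mu(x))$ and independent $B_x\sim\mathrm{Ber}(s)$, $x\in\mathcal{X}$; $\hat\mu_{t,s}=\frac{1}{st}\sum_xB_xP_x\delta_x$. Height function: $h_{q,L}(k)=\frac{q^{1-k}-q^{-L}}{q-1}\mathrm{diam}(\mathcal{X})$. For $j=0,\dots,L$, $Q_j\subset\mathcal{X}$ is a $q^{-j}\mathrm{diam}(\mathcal{X})$-cover of $\mathcal{X}$ of minimal cardinality (a set $S$ with every point of $\mathcal{X}$ within distance $q^{-j}\mathrm{diam}(\mathcal{X})$ of $S$). Define $$A_{q,p,L,\mathcal{X}}(l)=\mathrm{diam}(\mathcal{X})^p2^{p-1}\Big(q^{-Lp}|\mathcal{X}|^{1/2}+\Big(\tfrac{q}{q-1}\Big)^p\sum_{j=l}^Lq^{p-jp}|Q_j|^{1/2}\Big).$$ The constant $\mathcal{E}^{\mathrm{Poi}}_{p,\mathcal{X}}(C,q,L)$ is: $\frac{C^p}{2}$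 if $C\le\max\{2h_{q,L}(L),\min_{x\ne x'}d(x,x')\}$; otherwise $\big(\frac{C^p}{2}-2^{p-1}\big(\frac{q-q^{-L}}{q-1}\mathrm{diam}(\mathcal{X})\big)^p\big)+A_{q,p,L,\mathcal{X}}(1)$ if $C\ge2h_{q,L}(0)$; and otherwise $A_{q,p,L,\mathcal{X}}(l)$ where $l\in\{1,\dots,L\}$ is such that $2h_{q,L}(l)\le C<2h_{q,L}(l-1)$. *)

(* Defs.v *)
From HB Require Import structures.
From mathcomp Require Import all_boot all_order all_algebra.
From mathcomp Require Import all_classical all_reals all_analysis.
Set Implicit Arguments. Unset Strict Implicit. Unset Printing Implicit Defensive.
Import Order.TTheory GRing.Theory Num.Theory.
Local Open Scope classical_set_scope.
Local Open Scope ring_scope.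

Section Defs.
Context {R : realType} {T : finType}.

Definition is_metric (d : T -> T -> R) : Prop :=
  [/\ forall x y, 0 <= d x y,
      forall x y, d x y = 0 <-> x = y,
      forall x y, d x y = d y x &
      forall x y z, d x z <= d x y + d y z].

Definition mass (mu : T -> R) : R := \sum_(x : T) mu x.

Definition subcouplings (mu nu : T -> R) : set (T -> T -> R) :=
  [set pi | (forall x y, 0 <= pi x y) /\
            (forall x, \sum_(y : T) pi x y <= mu x) /\
            (forall y, \sum_(x : T) pi x y <= nu y)].

Definition pmass (pi : T -> T -> R) : R := \sum_(x : T) \sum_(y : T) pi x y.

Definition KR_cost (d : T -> T -> R) (p C : R) (mu nu : T -> R)
    (pi : T -> T -> R) : R :=
  \sum_(x : T) \sum_(y : T) (d x y `^ p) * pi x y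
  + (C `^ p) * ((mass mu + mass nu) / 2 - pmass pi).

(* KR_{p,C}(mu,nu); the minimum over the (compact, nonempty) polytope of
   sub-couplings is attained, so it equals the infimum used here. *)
Definition KR (d : T -> T -> R) (p C : R) (mu nu : T -> R) : R :=
  (inf [set KR_cost d p C mu nu pi | pi in subcouplings mu nu]) `^ (p^-1).

Definition poi_pmf (lam : R) (k : nat) : R := expR (- lam) * lam ^+ k / (k`!)%:R.
Definition ber_pmf (s : R) (b : bool) : R := if b then s else 1 - s.

Definition poisson_model_weight (mu : T -> R) (t s : R)
    (w : {ffun T -> nat} * {ffun T -> bool}) : R :=
  \prod_(x : T) (poi_pmf (t * mu x) (w.1 x) * ber_pmf s (w.2 x)).

Definition poisson_estimator (t s : R)
    (w : {ffun T -> nat} * {ffun T -> bool}) : T -> R :=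
  fun x => (s * t)^-1 * ((w.2 x)%:R * (w.1 x)%:R).

Definition expected_KR_poisson (d : T -> T -> R) (p C : R) (mu : T -> R)
    (t s : R) : \bar R :=
  \esum_(w in [set: {ffun T -> nat} * {ffun T -> bool}])
    (poisson_model_weight mu t s w * KR d p C (poisson_estimator t s w) mu)%:E.

Definition diam (d : T -> T -> R) : R :=
  \big[Num.max/0]_(x : T) \big[Num.max/0]_(y : T) d x y.

(* min_{x <> x'} d(x,x') (the default diam is never smaller than any d x y) *)
Definition min_dist (d : T -> T -> R) : R :=
  \big[Num.min/diam d]_(x : T) \big[Num.min/diam d]_(y : T | y != x) d x y.

Definition height (d : T -> T -> R) (q : R) (L k : nat) : R :=
  (q `^ (1 - k%:R) - q `^ (- L%:R)) / (q - 1) * diam d.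

Definition is_cover (d : T -> T -> R) (r : R) (S : {set T}) : bool :=
  [forall x : T, [exists y in S, d x y <= r]].

(* |Q_j|: minimal cardinality of a q^{-j} diam-cover
   (setT is always a cover, so #|T| is a harmless default) *)
Definition cover_number (d : T -> T -> R) (q : R) (j : nat) : nat :=
  \big[minn/#|T|]_(S : {set T} | is_cover d (q `^ (- j%:R) * diam d) S) #|S|.

(* A_{q,p,L,X}(l), with the factor q/(q-1) as a parameter c
   (c = q/(q-1) in general; c = 1 for the "moreover" part with p = 1) *)
Definition A_const (d : T -> T -> R) (c q p : R) (L l : nat) : R :=
  diam d `^ p * 2 `^ (p - 1) *
  (q `^ (- (L%:R * p)) * Num.sqrt (#|T|%:R)
   + c `^ p * \sum_(l <= j < L.+1)
        q `^ (p - j%:R * p) * Num.sqrt ((cover_number d q j)%:R)).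

Definition small_C (d : T -> T -> R) (C q : R) (L : nat) : bool :=
  C <= Num.max (2 * height d q L L) (min_dist d).

Definition level_index (d : T -> T -> R) (C q : R) (L : nat) : nat :=
  head 0%N [seq l <- iota 1 L |
             (2 * height d q L l <= C) && (C < 2 * height d q L l.-1)].

Definition E_poi (d : T -> T -> R) (c p C q : R) (L : nat) : R :=
  if small_C d C q L then C `^ p / 2
  else if 2 * height d q L 0 <= C then
    (C `^ p / 2 - 2 `^ (p - 1) * (((q - q `^ (- L%:R)) / (q - 1)) * diam d) `^ p)
    + A_const d c q p L 1
  else A_const d c q p L (level_index d C q L).

Definition poisson_bound (d : T -> T -> R) (c p C q : R) (L : nat)
    (mu : T -> R) (t s : R) : R :=
  E_poi d c p C q L `^ (p^-1) *
  (if small_C d C q L then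
     (2 * (1 - s) * mass mu + s / Num.sqrt t * \sum_(x : T) Num.sqrt (mu x)) `^ (p^-1)
   else
     ((s * t)^-1 * mass mu + (1 - s) / s * \sum_(x : T) mu x ^+ 2) `^ ((2 * p)^-1)).

End Defs.

(* Main.v *)
Require Import Defs.
From HB Require Import structures.
From mathcomp Require Import all_boot all_order all_algebra.
From mathcomp Require Import all_classical all_reals all_analysis.
From mathcomp Require Import ring lra zify.
Import Order.TTheory GRing.Theory Num.Theory numFieldNormedType.Exports.
Local Open Scope ring_scope.

Set Implicit Arguments.
Unset Strict Implicit.

(* Minimal covers at the scales q^-j diam, j = 0, ..., L, span a tree whose
   leaves are the points of X. Matching mass inside the nodes, level by level
   from the leaves upwards, yields a sub-coupling that leaves at each node only
   the difference of the masses of its two arguments; summation by parts bounds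
   KR^p by a nonnegative combination of the level sums S_j of the absolute mass
   differences at the nodes of level j. By independence the squared differences
   at one level have total expectation equal to the summed variance of the
   estimator, so by Cauchy-Schwarz S_j has expectation at most |Q_j|^(1/2) times
   the total standard deviation, and Jensen's inequality passes from KR^p to KR.
   For small C the leaf level alone is used, with a first-moment bound on
   |B P / (s t) - mu|.

   Every expectation is taken over a box {k < N} of Poisson counts. The truncated
   estimator is biased, but the bias vanishes as N grows. *)

(** * Averages over product weights *)

Section FiniteSums.
Context {R : realType}.

(** Multiplied by the total weight [a], the gap is the sum of the nonnegative terms
    [W i * (a * D i - b) ^+ 2]. If [a = 0], every weight vanishes. *)
Lemma weighted_cauchy_schwarz (I : finType) (W D : I -> R) :
  (forall i, 0 <= W i) ->
  (\sum_i W i * D i) ^+ 2 <= (\sum_i W i) * \sum_i W i * D i ^+ 2.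
Proof.
move=> W0; set a := \sum_i W i; set b := \sum_i W i * D i.
set c := \sum_i W i * D i ^+ 2.
have a0 : 0 <= a by exact: sumr_ge0.
have H : 0 <= a * (a * c - b ^+ 2).
  suff -> : a * (a * c - b ^+ 2) = \sum_i W i * (a * D i - b) ^+ 2.
    by apply: sumr_ge0 => i _; rewrite mulr_ge0 ?sqr_ge0.
  transitivity (\sum_i (a ^+ 2 * (W i * D i ^+ 2) + (- (2 * a * b)) * (W i * D i)
                         + b ^+ 2 * W i)).
    by rewrite !big_split /= -!mulr_sumr -/a -/b -/c; ring.
  by apply: eq_bigr => i _; ring.
have [a_eq0|a_neq0] := eqVneq a 0; last first.
  by move: H; rewrite pmulr_rge0 ?subr_ge0 // lt_def a_neq0.
suff -> : b = 0 by rewrite a_eq0 mul0r expr0n.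
rewrite /b big1 // => i _.
by rewrite (psumr_eq0P (fun i _ => W0 i) a_eq0) ?mul0r.
Qed.

Lemma weighted_abs_le_sqrt (I : finType) (W D : I -> R) (K V : R) :
  (forall i, 0 <= W i) -> \sum_i W i <= K -> \sum_i W i * D i ^+ 2 <= V ->
  \sum_i W i * `|D i| <= Num.sqrt K * Num.sqrt V.
Proof.
move=> W0 WK WV.
have K0 : 0 <= K by apply: le_trans WK; exact: sumr_ge0.
rewrite -sqrtrM // -[leLHS]ger0_norm -?sqrtr_sqr ?ler_wsqrtr //; last first.
  by apply: sumr_ge0 => i _; rewrite mulr_ge0.
apply: le_trans (weighted_cauchy_schwarz (fun i => `|D i|) W0) _.
apply: ler_pM => //; first exact: sumr_ge0.
  by apply: sumr_ge0 => i _; rewrite mulr_ge0 ?sqr_ge0.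
by rewrite (eq_bigr (fun i => W i * D i ^+ 2)) // => i _; rewrite real_normK ?num_real.
Qed.

End FiniteSums.

Section ProductWeights.
Context {R : realType} {T J : finType}.
Implicit Types (g Y : T -> J -> R) (w : {ffun T -> J}).

(** The factors [g x] need not have mass 1: truncated laws are only sub-probabilities, so the
    formulas below carry the masses of the remaining coordinates, later bounded by 1. *)
Definition prod_weight g w : R := \prod_x g x (w x).

Lemma prod_weight_ge0 g w : (forall x j, 0 <= g x j) -> 0 <= prod_weight g w.
Proof. by move=> g0; apply: prodr_ge0 => x _. Qed.

Lemma sum_prod_weightM g (u : T -> J -> R) :
  \sum_w prod_weight g w * \prod_x u x (w x) = \prod_x \sum_j g x j * u x j.
Proof.
rewrite bigA_distr_bigA /=; apply: eq_bigr => w _.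
by rewrite /prod_weight -big_split.
Qed.

Lemma sum_prod_weight g : \sum_w prod_weight g w = \prod_x \sum_j g x j.
Proof. by rewrite bigA_distr_bigA. Qed.


Lemma prod_mass_le1 g (P : pred T) :
  (forall x j, 0 <= g x j) -> (forall x, \sum_j g x j <= 1) ->
  0 <= \prod_(x | P x) \sum_j g x j <= 1.
Proof.
move=> g0 g1; rewrite prodr_ge0 /=; last by move=> x _; exact: sumr_ge0.
by apply: prodr_ile1 => x _; rewrite sumr_ge0 /=.
Qed.

Lemma sum_prod_weight_le1 g :
  (forall x j, 0 <= g x j) -> (forall x, \sum_j g x j <= 1) ->
  \sum_w prod_weight g w <= 1.
Proof.
by move=> g0 g1; rewrite sum_prod_weight; have /andP[] := prod_mass_le1 predT g0 g1.
Qed.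

Lemma prod_weight_marginal g x (f : J -> R) :
  \sum_w prod_weight g w * f (w x) =
  (\sum_j g x j * f j) * \prod_(z | z != x) \sum_j g z j.
Proof.
pose u z := if z == x then f else fun=> 1.
transitivity (\sum_w prod_weight g w * \prod_z u z (w z)).
  apply: eq_bigr => w _; congr (_ * _).
  rewrite (bigD1 x) //= /u eqxx big1 ?mulr1 // => z /negPf ->.
  by [].
rewrite sum_prod_weightM (bigD1 x) //= /u eqxx; congr (_ * _).
by apply: eq_bigr => z /negPf ->; under eq_bigr do rewrite mulr1.
Qed.

Lemma prod_weight_marginal_le g x (f : J -> R) :
  (forall x j, 0 <= g x j) -> (forall x, \sum_j g x j <= 1) ->
  (forall j, 0 <= f j) ->
  \sum_w prod_weight g w * f (w x) <= \sum_j g x j * f j.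
Proof.
move=> g0 g1 f0; rewrite prod_weight_marginal ler_piMr //.
  by apply: sumr_ge0 => j _; rewrite mulr_ge0.
by have /andP[] := prod_mass_le1 (predC1 x) g0 g1.
Qed.

(** Independence factorises the cross moment. The absolute values make it monotone in the leftover
    mass, which is only known to lie in [0, 1]. *)
Lemma prod_weight_cross_le g x y (f h : J -> R) : x != y ->
  (forall x j, 0 <= g x j) -> (forall x, \sum_j g x j <= 1) ->
  \sum_w prod_weight g w * (f (w x) * h (w y)) <=
  `|\sum_j g x j * f j| * `|\sum_j g y j * h j|.
Proof.
move=> xy g0 g1.
pose u z := if z == x then f else if z == y then h else fun=> 1.
have -> : \sum_w prod_weight g w * (f (w x) * h (w y)) =
    \sum_w prod_weight g w * \prod_z u z (w z).
  apply: eq_bigr => w _; congr (_ * _).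
  rewrite (bigD1 x) //= (bigD1 y) 1?eq_sym //= /u !eqxx (eq_sym y x) (negPf xy).
  by rewrite big1 ?mulr1 // => z /andP[/negPf -> /negPf ->].
rewrite sum_prod_weightM (bigD1 x) //= (bigD1 y) 1?eq_sym //=.
rewrite /u !eqxx (eq_sym y x) (negPf xy).
rewrite (eq_bigr (fun z => \sum_j g z j)) => [|z /andP[/negPf -> /negPf ->]]; last first.
  by under eq_bigr do rewrite mulr1.
rewrite mulrA; apply: le_trans (ler_norm _) _; rewrite !normrM ler_piMr ?mulr_ge0 //.
by have /andP[? ?] := prod_mass_le1 [pred z | z != x & z != y] g0 g1; rewrite ger0_norm.
Qed.

(** Cauchy-Schwarz on pairs (outcome, node), the node weighted by the indicator of [Q], so that the
    total weight is at most |Q|. The squared class sums expand into pairs inside a class: the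
    diagonal gives the second moments, and the other pairs give products of means, which are then
    extended to all pairs. *)
Lemma prod_weight_partition_le g Y (f : T -> T) (Q : {set T}) :
  (forall x j, 0 <= g x j) -> (forall x, \sum_j g x j <= 1) ->
  (forall x, f x \in Q) ->
  \sum_w prod_weight g w * (\sum_v `|\sum_(x | f x == v) Y x (w x)|) <=
  Num.sqrt #|Q|%:R *
  Num.sqrt (\sum_x \sum_j g x j * Y x j ^+ 2
            + (\sum_x `|\sum_j g x j * Y x j|) ^+ 2).
Proof.
move=> g0 g1 fQ.
pose W (i : {ffun T -> J} * T) := prod_weight g i.1 * (i.2 \in Q)%:R.
pose D (i : {ffun T -> J} * T) := \sum_(x | f x == i.2) Y x (i.1 x).
have W0 i : 0 <= W i by rewrite mulr_ge0 ?prod_weight_ge0.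
have -> : \sum_w prod_weight g w * (\sum_v `|\sum_(x | f x == v) Y x (w x)|) =
    \sum_i W i * `|D i|.
  rewrite -(pair_bigA _ (fun w v => W (w, v) * `|D (w, v)|)) /=.
  apply: eq_bigr => w _; rewrite mulr_sumr; apply: eq_bigr => v _.
  rewrite /W /D /=; case: (boolP (v \in Q)) => vQ; first by rewrite mulr1.
  rewrite big_pred0 ?normr0 ?mulr0 // => x.
  by apply: contraNF vQ => /eqP <-.
apply: weighted_abs_le_sqrt => //.
  rewrite -(pair_bigA _ (fun w v => W (w, v))) /=.
  rewrite /W /=; under eq_bigr do rewrite -mulr_sumr.
  rewrite -mulr_suml.
  have -> : \sum_v (v \in Q)%:R = #|Q|%:R :> R.
    by rewrite -sum1_card natr_sum [RHS]big_mkcond; apply: eq_bigr => v _; case: ifP.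
  by rewrite ler_piMl //; exact: sum_prod_weight_le1.
have -> : \sum_x \sum_j g x j * Y x j ^+ 2 + (\sum_x `|\sum_j g x j * Y x j|) ^+ 2 =
   \sum_x (\sum_j g x j * Y x j ^+ 2 +
     \sum_y `|\sum_j g x j * Y x j| * `|\sum_j g y j * Y y j|).
  by rewrite big_split /= expr2 mulr_suml; under [X in _ = _ + X]eq_bigr do rewrite -mulr_sumr.
apply: (@le_trans _ _ (\sum_x \sum_(y | f y == f x)
    \sum_w prod_weight g w * (Y x (w x) * Y y (w y)))).
  rewrite (eq_bigr _ (fun x _ => exchange_big _ _ _ _ _ _)) exchange_big /=.
  rewrite -(pair_bigA _ (fun w v => W (w, v) * D (w, v) ^+ 2)) /=.
  apply: ler_sum => w _.
  apply: (@le_trans _ _ (\sum_v prod_weight g w * D (w, v) ^+ 2)).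
    apply: ler_sum => v _; rewrite ler_wpM2r ?sqr_ge0 // /W /= ler_piMr ?prod_weight_ge0 //.
    by case: (_ \in _).
  rewrite [leRHS](partition_big f predT) //=; apply: ler_sum => v _.
  rewrite /D /= expr2 mulr_suml mulr_sumr; apply: ler_sum => x /eqP ->.
  by rewrite !mulr_sumr.
apply: ler_sum => x _; rewrite (bigD1 x) //=; apply: lerD.
  under eq_bigr do rewrite -expr2.
  by apply: (prod_weight_marginal_le x (f := fun j => Y x j ^+ 2)) => // j; exact: sqr_ge0.
rewrite [leLHS]big_mkcond; apply: ler_sum => y _.
case: ifP => [/andP[_ yx]|_]; last by rewrite mulr_ge0.
by apply: prod_weight_cross_le; rewrite // eq_sym.
Qed.

End ProductWeights.

(** * Moments of the truncated model *)

Section PoissonMoments.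
Context {R : realType}.
Local Open Scope classical_set_scope.
Implicit Types (lam : R) (k N : nat).

Lemma poi_pmf_ge0 lam k : 0 <= lam -> 0 <= poi_pmf lam k.
Proof. by move=> lam0; rewrite !mulr_ge0 ?expR_ge0 ?exprn_ge0 ?invr_ge0. Qed.

(** This recursion lowers the order of a factorial moment by one, at the price of a factor [lam]. *)
Lemma poi_pmfS lam k : poi_pmf lam k.+1 * k.+1%:R = lam * poi_pmf lam k.
Proof.
have k0 : k.+1%:R != 0 :> R by rewrite pnatr_eq0.
have kf0 : k`!%:R != 0 :> R by rewrite pnatr_eq0 -lt0n fact_gt0.
rewrite /poi_pmf factS natrM exprS; field.
by rewrite kf0 nat1r.
Qed.

Lemma cvg_poi_pmf_sum lam : (\sum_(k < N) poi_pmf lam k) @[N --> \oo] --> (1 : R).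
Proof.
have -> : (fun N => \sum_(k < N) poi_pmf lam k) =
          (fun N => expR (- lam) * series (exp_coeff lam) N).
  apply/funext => N; rewrite /series /= big_mkord mulr_sumr.
  by apply: eq_bigr => k _; rewrite /poi_pmf /exp_coeff /= mulrA.
rewrite -(expRxMexpNx_1 lam) mulrC; apply: cvgMr.
exact: is_cvg_series_exp_coeff.
Qed.

Lemma cvg_poi_pmf_mean lam : (\sum_(k < N) poi_pmf lam k * k%:R) @[N --> \oo] --> lam.
Proof.
rewrite -(cvg_shiftS (fun N => \sum_(k < N) poi_pmf lam k * k%:R)) /=.
have -> : (fun N => \sum_(k < N.+1) poi_pmf lam k * k%:R) =
          (fun N => lam * \sum_(k < N) poi_pmf lam k).
  apply/funext => N; rewrite big_ord_recl mulr0 add0r mulr_sumr.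
  by apply: eq_bigr => k _; rewrite poi_pmfS.
suff: (lam * \sum_(k < N) poi_pmf lam k) @[N --> \oo] --> lam * 1 by rewrite mulr1.
by apply: cvgMr; exact: cvg_poi_pmf_sum.
Qed.

Lemma cvg_poi_pmf_factorial2 lam :
  (\sum_(k < N) poi_pmf lam k * (k%:R * (k%:R - 1))) @[N --> \oo] --> lam ^+ 2.
Proof.
rewrite -(cvg_shiftS (fun N => \sum_(k < N) poi_pmf lam k * (k%:R * (k%:R - 1)))) /=.
have -> : (fun N => \sum_(k < N.+1) poi_pmf lam k * (k%:R * (k%:R - 1))) =
          (fun N => lam * \sum_(k < N) poi_pmf lam k * k%:R).
  apply/funext => N; rewrite big_ord_recl mul0r mulr0 add0r mulr_sumr.
  apply: eq_bigr => k _.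
  by rewrite lift0 [LHS]mulrA poi_pmfS -[k.+1%:R]natr1 addrK -mulrA.
by rewrite expr2; apply: cvgMr; exact: cvg_poi_pmf_mean.
Qed.

Lemma cvg_poi_pmf_quadratic lam (phi : nat -> R) (u v w : R) :
  (forall k, phi k = u * k%:R ^+ 2 + v * k%:R + w) ->
  (\sum_(k < N) poi_pmf lam k * phi k) @[N --> \oo] -->
  u * (lam ^+ 2 + lam) + v * lam + w.
Proof.
move=> phiE.
(* In falling factorials the linear coefficient becomes [u + v]. *)
have -> : (fun N => \sum_(k < N) poi_pmf lam k * phi k) =
    (fun N => u * \sum_(k < N) poi_pmf lam k * (k%:R * (k%:R - 1))
              + (u + v) * (\sum_(k < N) poi_pmf lam k * k%:R)
              + w * \sum_(k < N) poi_pmf lam k).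
  apply/funext => N; rewrite !mulr_sumr -!big_split /=.
  by apply: eq_bigr => k _; rewrite phiE; ring.
have -> : u * (lam ^+ 2 + lam) + v * lam + w = u * lam ^+ 2 + (u + v) * lam + w * 1.
  by ring.
apply: cvgD; [apply: cvgD|]; apply: cvgMr.
- exact: cvg_poi_pmf_factorial2.
- exact: cvg_poi_pmf_mean.
- exact: cvg_poi_pmf_sum.
Qed.

(** Partial sums of nonnegative terms increase to the Poisson expectation, so its closed form bounds
    every truncation. *)
Lemma poi_pmf_quadratic_le lam (phi : nat -> R) (u v w : R) N :
  0 <= lam -> (forall k, 0 <= phi k) ->
  (forall k, phi k = u * k%:R ^+ 2 + v * k%:R + w) ->
  \sum_(k < N) poi_pmf lam k * phi k <= u * (lam ^+ 2 + lam) + v * lam + w.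
Proof.
move=> lam0 phi0 phiE; have cvg_phi := cvg_poi_pmf_quadratic (lam := lam) phiE.
rewrite -(cvg_lim _ cvg_phi) //.
apply: (nondecreasing_cvgn_le (u_ := fun N => \sum_(k < N) poi_pmf lam k * phi k)).
  apply/nondecreasing_seqP => n; rewrite big_ord_recr /= lerDl.
  by rewrite mulr_ge0 ?poi_pmf_ge0.
by apply/cvg_ex; eexists; exact: cvg_phi.
Qed.

Lemma poi_pmf_sum_le1 lam N : 0 <= lam -> \sum_(k < N) poi_pmf lam k <= 1.
Proof.
move=> lam0; have := @poi_pmf_quadratic_le lam (fun=> 1) 0 0 1 N lam0.
rewrite !mul0r !add0r; under eq_bigr do rewrite mulr1.
by apply=> // k; rewrite !mul0r !add0r.
Qed.

Lemma poi_pmf_abs_dev_le lam N : 0 <= lam ->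
  \sum_(k < N) poi_pmf lam k * `|k%:R - lam| <= Num.sqrt lam.
Proof.
move=> lam0; rewrite -[leRHS]mul1r -[X in X * _]sqrtr1.
apply: weighted_abs_le_sqrt; first by move=> k; exact: poi_pmf_ge0.
  exact: poi_pmf_sum_le1.
apply: (@le_trans _ _ (1 * (lam ^+ 2 + lam) + (- 2 * lam) * lam + lam ^+ 2)).
  apply: (poi_pmf_quadratic_le (phi := fun k => (k%:R - lam) ^+ 2)) => // k.
    by rewrite sqr_ge0.
  by ring.
by have -> : 1 * (lam ^+ 2 + lam) + (- 2 * lam) * lam + lam ^+ 2 = lam by ring.
Qed.

End PoissonMoments.

(** * Thinned Poisson coordinates: variance, mean deviation and bias *)

Section TruncatedModel.
Context {R : realType} {T : finType}.
Variables (mu : T -> R) (t s : R) (N : nat).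
Hypotheses (mu0 : forall x, 0 <= mu x) (t0 : 0 < t) (s01 : 0 < s <= 1).

Definition box_pmf (x : T) (j : 'I_N * bool) : R :=
  poi_pmf (t * mu x) j.1 * ber_pmf s j.2.

(** Centred at the untruncated mean [mu x]; its average over the box is the bias. *)
Definition box_dev (x : T) (j : 'I_N * bool) : R :=
  (s * t)^-1 * (j.2%:R * j.1%:R) - mu x.

Lemma box_pmf_ge0 x j : 0 <= box_pmf x j.
Proof.
case/andP: s01 => s0 s1.
rewrite mulr_ge0 ?poi_pmf_ge0 ?mulr_ge0 ?(ltW t0) //.
by rewrite /ber_pmf; case: ifP; rewrite ?subr_ge0 // ltW.
Qed.

Lemma box_pmf_sumM x (f : nat -> bool -> R) :
  \sum_j box_pmf x j * f j.1 j.2 =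
  \sum_(k < N) poi_pmf (t * mu x) k * (s * f k true + (1 - s) * f k false).
Proof.
rewrite -(pair_bigA _ (fun k b => box_pmf x (k, b) * f k b)) /=.
apply: eq_bigr => k _.
by rewrite big_bool /box_pmf /ber_pmf /=; ring.
Qed.

Lemma box_pmf_sum_le1 x : \sum_j box_pmf x j <= 1.
Proof.
have := box_pmf_sumM x (fun _ _ => 1); under eq_bigr do rewrite mulr1.
move=> ->; rewrite !mulr1 addrC subrK; under eq_bigr do rewrite mulr1.
by apply: poi_pmf_sum_le1; rewrite mulr_ge0 // ltW.
Qed.

Lemma box_var_le x :
  \sum_j box_pmf x j * box_dev x j ^+ 2 <=
  (s * t)^-1 * mu x + (1 - s) / s * mu x ^+ 2.
Proof.
have /andP[s0 s1] := s01.
have [s_neq0 t_neq0] : s != 0 /\ t != 0 by rewrite !gt_eqF.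
rewrite (box_pmf_sumM x (fun k b => ((s * t)^-1 * (b%:R * k%:R) - mu x) ^+ 2)).
(* The coefficients of k^2 and k once the Bernoulli variable is averaged out; the constant one is
   [mu x ^+ 2]. *)
pose u := s * (s * t)^-1 ^+ 2; pose v := - 2 * s * (s * t)^-1 * mu x.
have -> : (s * t)^-1 * mu x + (1 - s) / s * mu x ^+ 2 =
  u * ((t * mu x) ^+ 2 + t * mu x) + v * (t * mu x) + mu x ^+ 2.
  by rewrite /u /v; field; rewrite s_neq0 t_neq0.
apply: (poi_pmf_quadratic_le (phi := fun k => s * ((s * t)^-1 * (true%:R * k%:R) - mu x) ^+ 2
  + (1 - s) * ((s * t)^-1 * (false%:R * k%:R) - mu x) ^+ 2)).
- by rewrite mulr_ge0 // ltW.
- by move=> k; apply: addr_ge0; apply: mulr_ge0; rewrite ?sqr_ge0 ?subr_ge0 ?(ltW s0).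
- by move=> k; rewrite /u /v /=; ring.
Qed.

(* The factor s in front of sqrt (mu x) comes from the convexity bound
   |k - s lam| <= (1 - s) k + s |k - lam|. *)
Lemma box_abs_dev_le x :
  \sum_j box_pmf x j * `|box_dev x j| <=
  2 * (1 - s) * mu x + s / Num.sqrt t * Num.sqrt (mu x).
Proof.
have /andP[s0 s1] := s01.
have [s_neq0 t_neq0] : s != 0 /\ t != 0 by rewrite !gt_eqF.
have lam0 : 0 <= t * mu x by rewrite mulr_ge0 // ltW.
rewrite (box_pmf_sumM x (fun k b => `|(s * t)^-1 * (b%:R * k%:R) - mu x|)).
apply: (@le_trans _ _ (\sum_(k < N) poi_pmf (t * mu x) k *
   ((1 - s) * (t^-1 * k%:R + mu x) + s / t * `|k%:R - t * mu x|))).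
  apply: ler_sum => k _; rewrite ler_wpM2l ?poi_pmf_ge0 //=.
  rewrite mul0r mulr0 sub0r normrN (ger0_norm (mu0 x)) mul1r mulrDr addrAC lerD2r.
  have -> : s * `|(s * t)^-1 * k%:R - mu x| =
      `|(1 - s) * (t^-1 * k%:R) + s / t * (k%:R - t * mu x)|.
    rewrite -[X in X * _]gtr0_norm // -normrM; congr `|_|; field.
    by rewrite ?s_neq0 ?t_neq0.
  have e1 : 0 <= (1 - s) * (t^-1 * k%:R).
    by rewrite !mulr_ge0 ?subr_ge0 ?invr_ge0 // ltW.
  have e2 : 0 <= s / t by rewrite divr_ge0 // ltW.
  by apply: le_trans (ler_normD _ _) _; rewrite (ger0_norm e1) normrM (ger0_norm e2).
under eq_bigr do rewrite mulrDr [X in _ + X]mulrCA.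
rewrite big_split /= -mulr_sumr.
(* One share (1 - s) mu comes from the outcomes with B = 0, the other from the convexity bound; the
   leading 0 fits the shape of [poi_pmf_quadratic_le]. *)
have -> : 2 * (1 - s) * mu x + s / Num.sqrt t * Num.sqrt (mu x) =
   (0 * ((t * mu x) ^+ 2 + t * mu x) + ((1 - s) / t) * (t * mu x) + (1 - s) * mu x)
   + s / t * Num.sqrt (t * mu x).
  have r0 : 0 < Num.sqrt t by rewrite sqrtr_gt0.
  have rE : s / t * Num.sqrt t = s / Num.sqrt t.
    by rewrite -[X in s / X * _](sqr_sqrtr (ltW t0)); field; rewrite gt_eqF.
  by rewrite sqrtrM ?ltW // [s / t * _]mulrA rE; field; rewrite ?t_neq0 ?gt_eqF.
apply: lerD; last by rewrite ler_wpM2l ?poi_pmf_abs_dev_le // divr_ge0 // ltW.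
apply: (poi_pmf_quadratic_le (phi := fun k => (1 - s) * (t^-1 * k%:R + mu x))) => // k.
  by rewrite mulr_ge0 ?subr_ge0 // addr_ge0 // mulr_ge0 // invr_ge0 ltW.
by ring.
Qed.

End TruncatedModel.

Arguments box_pmf {R T} mu t s {N} x j.
Arguments box_dev {R T} mu t s {N} x j.

Lemma cvg_box_bias (R : realType) (T : finType) (mu : T -> R) (t s : R) x :
  0 < t -> 0 < s <= 1 ->
  ((\sum_(j : 'I_N * bool) box_pmf mu t s x j * box_dev mu t s x j)
     @[N --> \oo] --> (0 : R))%classic.
Proof.
move=> t0 /andP[s0 s1].
have [s_neq0 t_neq0] : s != 0 /\ t != 0 by rewrite !gt_eqF.
have -> : (fun N => \sum_(j : 'I_N * bool) box_pmf mu t s x j * box_dev mu t s x j) =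
    (fun N => \sum_(k < N) poi_pmf (t * mu x) k * (t^-1 * k%:R - mu x)).
  apply/funext => N.
  rewrite (box_pmf_sumM mu t s N x (fun k b => (s * t)^-1 * (b%:R * k%:R) - mu x)).
  by apply: eq_bigr => k _; congr (_ * _); rewrite /=; field; rewrite ?s_neq0 ?t_neq0.
have := @cvg_poi_pmf_quadratic R (t * mu x) (fun k => t^-1 * k%:R - mu x) 0 t^-1 (- mu x).
have -> : 0 * ((t * mu x) ^+ 2 + t * mu x) + t^-1 * (t * mu x) - mu x = 0 by field.
by apply=> k; ring.
Qed.

(** * Hierarchical couplings *)

Section Coupling.
Context {R : realType} {T : finType}.
Implicit Types (a b mu nu : T -> R) (pi : T -> T -> R).

(** The L1 distance between the images of [a] and [b] under [f]; the fibres of [f] play the role of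
    the nodes of one level. *)
Definition imbalance (f : T -> T) a b : R :=
  \sum_v `|\sum_(x | f x == v) (a x - b x)|.

Lemma imbalance_ge0 f a b : 0 <= imbalance f a b.
Proof. exact: sumr_ge0. Qed.

Lemma pmass_exchange pi : pmass pi = \sum_y \sum_x pi x y.
Proof. exact: exchange_big. Qed.

(* Within a class of total masses A and B, the coupling
   a x * b y / max A B transports exactly min A B. *)
Lemma class_coupling (f : T -> T) a b :
  (forall x, 0 <= a x) -> (forall x, 0 <= b x) ->
  exists2 pi, subcouplings a b pi
    & (forall x y, f x != f y -> pi x y = 0)
      /\ mass a + mass b - 2 * pmass pi = imbalance f a b.
Proof.
move=> a0 b0.
pose A v := \sum_(x | f x == v) a x; pose B v := \sum_(x | f x == v) b x.
pose M v := Num.max (A v) (B v).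
have A0 v : 0 <= A v by exact: sumr_ge0.
have B0 v : 0 <= B v by exact: sumr_ge0.
have M0 v : 0 <= M v by rewrite le_max A0.
(* A class without mass has [M v = 0], and the quotient is then 0 by convention. *)
have ratio u v : 0 <= u -> u <= M v -> u / M v <= 1.
  move=> u0 uM; have [->|M_neq0] := eqVneq (M v) 0; first by rewrite invr0 mulr0.
  by rewrite ler_pdivrMr ?mul1r // lt_def M_neq0 M0.
pose pi x y := if f x == f y then a x * (b y / M (f x)) else 0.
have rowE x : \sum_y pi x y = a x * (B (f x) / M (f x)).
  rewrite /pi -big_mkcond /= -mulr_sumr -mulr_suml.
  by congr (_ * (_ / _)); apply: eq_bigl => y; rewrite eq_sym.
have colE y : \sum_x pi x y = b y * (A (f y) / M (f y)).
  rewrite /pi -big_mkcond /= (eq_bigr (fun x => a x * (b y / M (f y)))) => [|x /eqP -> //].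
  by rewrite -mulr_suml /A; ring.
exists pi; [split; [|split]|split].
- by move=> x y; rewrite /pi; case: ifP => // _; rewrite !mulr_ge0 ?invr_ge0.
- by move=> x; rewrite rowE ler_piMr // ratio // le_max lexx orbT.
- by move=> y; rewrite colE ler_piMr // ratio // le_max lexx.
- by move=> x y; rewrite /pi => /negPf ->.
rewrite /mass /pmass /imbalance (partition_big f predT) //=.
rewrite (partition_big f predT (F := b)) //=.
rewrite (partition_big f predT (F := fun x => \sum_y pi x y)) //=.
rewrite mulr_sumr -big_split -sumrB /=; apply: eq_bigr => v _.
rewrite sumrB -/(A v) -/(B v).
have -> : \sum_(x | f x == v) \sum_y pi x y = A v * B v / M v.
  rewrite (eq_bigr (fun x => a x * (B v / M v))) => [|x /eqP <-]; last by rewrite rowE.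
  by rewrite -mulr_suml mulrA.
have [M_eq0|M_neq0] := eqVneq (M v) 0.
  have Av : A v = 0 by apply/eqP; rewrite eq_le A0 andbT -M_eq0 le_max lexx.
  have Bv : B v = 0 by apply/eqP; rewrite eq_le B0 andbT -M_eq0 le_max lexx orbT.
  by rewrite Av Bv !mul0r mulr0 subrr normr0 addr0 subr0.
move: M_neq0; rewrite /M; case: (leP (A v) (B v)) => AB ne0.
  by rewrite mulfK // ler0_norm ?subr_le0 //; ring.
by rewrite [A v * B v]mulrC mulfK // gtr0_norm ?subr_gt0 //; ring.
Qed.

(* Match as much mass as possible inside the classes of f 0, then match the
   leftovers inside the coarser classes of f 1, and so on. *)
Lemma hierarchical_coupling (c : T -> T -> R) (f : nat -> T -> T) (r : nat -> R)
    (n : nat) a b :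
  (forall x, 0 <= a x) -> (forall x, 0 <= b x) ->
  injective (f 0%N) -> (forall x, c x x = 0) ->
  (forall i x y, f i x = f i y -> f i.+1 x = f i.+1 y) ->
  (forall i x y, (0 < i)%N -> (i <= n)%N -> f i x = f i y -> c x y <= r i) ->
  exists2 pi, subcouplings a b pi
    & [/\ forall x y, f n x != f n y -> pi x y = 0,
          mass a + mass b - 2 * pmass pi = imbalance (f n) a b
        & \sum_x \sum_y c x y * pi x y <=
          \sum_(i < n) r i.+1 * (imbalance (f i) a b - imbalance (f i.+1) a b) / 2].
Proof.
move=> a0 b0 f0_inj c0 f_mono; elim: n => [|n IHn] cr.
  (* Since [f 0] is injective, this coupling lives on the diagonal and costs nothing. *)
  have [pi pi_sub [pi_supp pi_mass]] := class_coupling (f 0%N) a0 b0.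
  exists pi => //; split => //; rewrite big_ord0 big1 // => x _; rewrite big1 // => y _.
  have [->|xy] := eqVneq x y; first by rewrite c0 mul0r.
  by rewrite pi_supp ?mulr0 // (inj_eq f0_inj).
have [|pi [pi0 [pi_row pi_col]] [pi_supp pi_mass pi_cost]] := IHn.
  by move=> i x y i0 le_in; apply: cr => //; rewrite leqW.
pose a' x := a x - \sum_y pi x y; pose b' y := b y - \sum_x pi x y.
have a'0 x : 0 <= a' x by rewrite subr_ge0.
have b'0 x : 0 <= b' x by rewrite subr_ge0.
have [pi' [pi'0 [pi'_row pi'_col]] [pi'_supp pi'_mass]] :=
  class_coupling (f n.+1) a'0 b'0.
have mass_a' : mass a' = mass a - pmass pi by rewrite /mass /a' sumrB.
have mass_b' : mass b' = mass b - pmass pi by rewrite /mass /b' sumrB pmass_exchange.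
(* The classes of [f n] refine those of [f n.+1], so [pi] removes equal masses from both sides of
   each coarser class, and the leftovers keep the imbalance of [a] and [b] there. *)
have class_pi v : \sum_(x | f n.+1 x == v) \sum_y pi x y =
                  \sum_(y | f n.+1 y == v) \sum_x pi x y.
  have restr (F : T -> T -> R) : (forall x y, f n.+1 x != f n.+1 y -> F x y = 0) ->
      \sum_(x | f n.+1 x == v) \sum_y F x y =
      \sum_(x | f n.+1 x == v) \sum_(y | f n.+1 y == v) F x y.
    move=> F0; apply: eq_bigr => x /eqP fx; rewrite (bigID (fun y => f n.+1 y == v)) /=.
    by rewrite [X in _ + X]big1 ?addr0 // => y fy; rewrite F0 // fx eq_sym.
  have pi_supp' x y : f n.+1 x != f n.+1 y -> pi x y = 0.
    by move=> fxy; apply: pi_supp; apply: contraNneq fxy => /f_mono ->.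
  rewrite restr // (restr (fun y x => pi x y)) => [|y x]; last by rewrite eq_sym => /pi_supp'.
  exact: exchange_big.
have imb' : imbalance (f n.+1) a' b' = imbalance (f n.+1) a b.
  apply: eq_bigr => v _; congr `|_|.
  by rewrite /a' /b' !sumrB class_pi; ring.
have pmassD : pmass (fun x y => pi x y + pi' x y) = pmass pi + pmass pi'.
  by rewrite /pmass -big_split /=; apply: eq_bigr => x _; rewrite big_split.
(* Each unit matched lowers the total unmatched mass of the two sides by two. *)
have pmass_pi' : pmass pi' = (imbalance (f n) a b - imbalance (f n.+1) a b) / 2.
  by rewrite -pi_mass -imb' -pi'_mass mass_a' mass_b'; field.
exists (fun x y => pi x y + pi' x y); [split; [|split]|split].
- by move=> x y; rewrite addr_ge0.
- by move=> x; rewrite big_split /= -lerBrDl.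
- by move=> y; rewrite big_split /= -lerBrDl.
- move=> x y fxy; rewrite pi'_supp // addr0.
  by apply: pi_supp; apply: contraNneq fxy => /f_mono ->.
- by rewrite pmassD -imb' -pi'_mass mass_a' mass_b'; ring.
rewrite big_ord_recr /=.
under eq_bigr do under eq_bigr do rewrite mulrDr.
under eq_bigr do rewrite big_split /=.
rewrite big_split /=; apply: lerD => //.
rewrite -mulrA -pmass_pi' /pmass mulr_sumr; apply: ler_sum => x _.
rewrite mulr_sumr; apply: ler_sum => y _.
have [fxy|fxy] := eqVneq (f n.+1 x) (f n.+1 y); last by rewrite pi'_supp ?mulr0.
by rewrite ler_wpM2r // (cr n.+1).
Qed.

(** Trades drops of [S], which upper bounds on [S] do not control, for the values [S i] themselves,
    with coefficients that are nonnegative when the costs [r] are nonnegative and increase. *)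
Lemma sum_by_parts (r S : nat -> R) n :
  \sum_(i < n) r i.+1 * (S i - S i.+1) + r n.+1 * S n =
  r 1%N * S 0%N + \sum_(i < n) (r i.+2 - r i.+1) * S i.+1.
Proof.
elim: n => [|n IHn]; first by rewrite !big_ord0 addr0 add0r.
by rewrite !big_ord_recr /= addrA -IHn; ring.
Qed.

Lemma KR_cost_ge0 (d : T -> T -> R) p C mu nu pi :
  subcouplings mu nu pi -> 0 <= KR_cost d p C mu nu pi.
Proof.
move=> [pi0 [pi_row pi_col]]; apply: addr_ge0.
  by apply: sumr_ge0 => x _; apply: sumr_ge0 => y _; rewrite mulr_ge0 ?powR_ge0.
rewrite mulr_ge0 ?powR_ge0 // subr_ge0 ler_pdivlMr // mulr_natr mulr2n.
by apply: lerD; [|rewrite pmass_exchange]; exact: ler_sum.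
Qed.

(** KR before the root is taken: the bounds are linear at this stage, and the root is restored by
    Jensen's inequality. *)
Definition KR_pow (d : T -> T -> R) p C mu nu : R :=
  inf [set KR_cost d p C mu nu pi | pi in subcouplings mu nu]%classic.

Lemma KR_pow_le (d : T -> T -> R) p C mu nu pi :
  subcouplings mu nu pi -> KR_pow d p C mu nu <= KR_cost d p C mu nu pi.
Proof.
move=> pi_sub; apply: ge_inf; last by exists pi.
by exists 0 => _ [pi' pi'_sub <-]; exact: KR_cost_ge0.
Qed.

Lemma KR_pow_ge0 (d : T -> T -> R) p C mu nu :
  (forall x, 0 <= mu x) -> (forall x, 0 <= nu x) -> 0 <= KR_pow d p C mu nu.
Proof.
move=> mu0 nu0; apply: lb_le_inf => [|_ [pi pi_sub <-]]; last exact: KR_cost_ge0.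
have [pi pi_sub _] := class_coupling id mu0 nu0.
by exists (KR_cost d p C mu nu pi), pi.
Qed.

(** The hierarchical coupling is stopped at level [n]: what is left unmatched is [imbalance (f n)],
    charged [C ^ p / 2] per unit. *)
Lemma KR_pow_hierarchical_le (d : T -> T -> R) p C (f : nat -> T -> T) (r : nat -> R) n mu nu :
  (forall x, 0 <= mu x) -> (forall x, 0 <= nu x) ->
  injective (f 0%N) -> (forall x, d x x `^ p = 0) ->
  (forall i x y, f i x = f i y -> f i.+1 x = f i.+1 y) ->
  (forall i x y, (0 < i)%N -> (i <= n)%N -> f i x = f i y -> d x y `^ p <= r i) ->
  KR_pow d p C mu nu <=
  (\sum_(i < n) r i.+1 * (imbalance (f i) mu nu - imbalance (f i.+1) mu nu)
   + C `^ p * imbalance (f n) mu nu) / 2.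
Proof.
move=> mu0 nu0 f0 d0 f_mono dr.
have [pi pi_sub [_ pi_mass pi_cost]] := hierarchical_coupling mu0 nu0 f0 d0 f_mono dr.
apply: le_trans (KR_pow_le _ _ _ pi_sub) _; rewrite /KR_cost [leRHS]mulrDl.
apply: lerD; first by rewrite mulr_suml.
by rewrite -pi_mass -mulrA le_eqVlt; apply/orP; left; apply/eqP; congr (_ * _); field.
Qed.

End Coupling.

(** * The covering tree *)

(** Scales [j] are counted from the root, tree levels [i] from the leaves; this passes from one to
    the other. *)
Lemma sum_nat_rev (V : nmodType) (F : nat -> V) (l n : nat) :
  \sum_(l <= j < n.+1) F j = \sum_(i < n.+1 - l) F (n - i)%N.
Proof.
rewrite -{1}[l]add0n big_addn big_nat_rev big_mkord; apply: eq_bigr => i _.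
by congr F; have := ltn_ord i; lia.
Qed.

Section Tree.
Context {R : realType} {T : finType}.
Variables (d : T -> T -> R) (q : R) (L : nat).
Hypotheses (d_metric : is_metric d) (T2 : (1 < #|T|)%N) (q1 : 1 < q).

Lemma le_diam x y : d x y <= diam d.
Proof.
apply: le_trans (le_bigmax 0 (fun x => \big[Num.max/0]_y d x y) x).
exact: le_bigmax.
Qed.

Lemma diam_ge0 : 0 <= diam d.
Proof.
have /card_gt0P[x _] : (0 < #|T|)%N by apply: ltn_trans T2.
by apply: le_trans (le_diam x x); have [d0 _ _ _] := d_metric.
Qed.

Let q0 : 0 < q. Proof. exact: lt_trans q1. Qed.
Let qn0 : q != 0. Proof. by rewrite gt_eqF. Qed.
Let qB1 : 0 < q - 1. Proof. by rewrite subr_gt0. Qed.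

(** For [k <= L], [height] is thus the geometric sum of the radii q^-j diam over j = k, ..., L, and
    it vanishes at [L.+1]. *)
Lemma heightS k : height d q L k = height d q L k.+1 + q `^ (- k%:R) * diam d.
Proof.
rewrite /height -natr1 opprD addrCA subrr addr0 powRB ?qn0 ?implybT //.
rewrite powRr1 ?ltW // -powRN; field.
by rewrite gt_eqF.
Qed.

Lemma height_last : height d q L L = q `^ (- L%:R) * diam d.
Proof. by rewrite heightS /height -natr1 opprD addrCA subrr addr0 subrr !mul0r add0r. Qed.

Lemma height_ge0 k : (k <= L.+1)%N -> 0 <= height d q L k.
Proof.
move=> kL; rewrite mulr_ge0 ?diam_ge0 ?divr_ge0 ?(ltW qB1) // subr_ge0.
have kL' : k%:R <= L%:R + 1 :> R by rewrite natr1 ler_nat.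
by apply: ler_powR; [exact: ltW|lra].
Qed.

(** The finite geometric sum is bounded by the whole series; this is where the factor q/(q-1)
    arises. *)
Lemma height_le k : height d q L k <= q / (q - 1) * q `^ (- k%:R) * diam d.
Proof.
rewrite ler_wpM2r ?diam_ge0 // mulrAC ler_wpM2r ?invr_ge0 ?(ltW qB1) //.
rewrite -[X in _ <= X * _]powRr1 ?(ltW q0) // -powRD ?qn0 ?implybT //.
by rewrite gerBl powR_ge0.
Qed.

(** Induction over the iterated minimum; its default [#|T|] is realised by the full set. *)
Lemma ex_small_cover j :
  exists2 S : {set T}, is_cover d (q `^ (- j%:R) * diam d) S
    & (#|S| <= cover_number d q j)%N.
Proof.
rewrite /cover_number; elim/big_ind: _ => [|m n [S S_cov Sm] [S' S'_cov S'n]|S S_cov].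
- exists (finset.setT : {set T}); last by rewrite cardsT.
  apply/forallP => x; apply/existsP; exists x; rewrite inE /=.
  have [_ d0 _ _] := d_metric.
  by rewrite (d0 x x).2 // mulr_ge0 ?powR_ge0 ?diam_ge0.
- by case: (leqP m n) => _; [exists S|exists S'].
- by exists S.
Qed.

Lemma cover_number0 : (cover_number d q 0 <= 1)%N.
Proof.
have /card_gt0P[z _] : (0 < #|T|)%N by apply: ltn_trans T2.
have z_cov : is_cover d (q `^ (- 0%:R) * diam d) [set z]%SET.
  apply/forallP => x; apply/existsP; exists z.
  by rewrite inE eqxx /= oppr0 powRr0 mul1r le_diam.
rewrite -(cards1 z) /cover_number.
have : [set z]%SET \in index_enum {set T} by rewrite mem_index_enum.
elim: (index_enum _) => // S r IHr; rewrite inE big_cons => /predU1P[<-|/IHr le_r].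
  by rewrite z_cov geq_minl.
by case: ifP => // _; apply: leq_trans (geq_minr _ _) le_r.
Qed.

(* The paper's tree, read upwards from the leaves: f i x is the ancestor of x
   in Q_(L.+1 - i), and f 0 x = x. *)
Lemma ex_tree :
  exists f : nat -> T -> T, exists Q : nat -> {set T},
  [/\ injective (f 0%N), forall i x y, f i x = f i y -> f i.+1 x = f i.+1 y,
      forall i x, f i x \in Q i,
      forall i, (#|Q i.+1| <= cover_number d q (L - i))%N
    & forall i x, (i <= L.+1)%N -> d x (f i x) <= height d q L (L.+1 - i)].
Proof.
have [_ d0 _ d_triangle] := d_metric.
have [Q0 Q0P] : exists Q0 : nat -> {set T}, forall j,
    is_cover d (q `^ (- j%:R) * diam d) (Q0 j) /\ (#|Q0 j| <= cover_number d q j)%N.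
  have /choice[Q0 Q0P] : forall j, exists S : {set T},
      is_cover d (q `^ (- j%:R) * diam d) S /\ (#|S| <= cover_number d q j)%N.
    by move=> j; have [S S1 S2] := ex_small_cover j; exists S.
  by exists Q0.
have /choice[proj projP] : forall jx : nat * T, exists y : T,
    y \in Q0 jx.1 /\ d jx.2 y <= q `^ (- jx.1%:R) * diam d.
  move=> [j x] /=; have [/forallP/(_ x)/existsP[y /andP[yQ dxy]] _] := Q0P j.
  by exists y.
(* Projecting from the child, not from the leaf, makes the classes nested; the radii along a branch
   add up to [height]. *)
pose f := fix f i x := if i is i'.+1 then proj ((L - i')%N, f i' x) else x.
exists f, (fun i => if i is i'.+1 then Q0 (L - i')%N else finset.setT); split.
- by [].
- by move=> i x y /= ->.
- by move=> [|i] x /=; [rewrite inE|have [] := projP ((L - i)%N, f i x)].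
- by move=> i; have [] := Q0P (L - i)%N.
elim=> [|i IHi] x iL.
  by rewrite (d0 x x).2 // height_ge0.
have iL' : (i <= L)%N by [].
apply: le_trans (d_triangle _ (f i x) _) _.
rewrite subSS [leRHS]heightS -subSn // lerD // ?IHi ?leqW //=.
by have [] := projP ((L - i)%N, f i x).
Qed.

(** * Level weights and their comparison with [E_poi] *)

Section Bound.
Variables (p C c : R).
Hypotheses (p1 : 1 <= p) (C0 : 0 < C).
Hypothesis c_spec : c = q / (q - 1) \/ p = 1 /\ c = 1.

Let p0 : 0 <= p. Proof. exact: le_trans p1. Qed.

(** Two leaves below a common node are at most twice its height apart. *)
Definition level_cost i : R := (2 * height d q L (L.+1 - i)) `^ p.

(** The coefficients of the imbalances after summation by parts, halved as in
    [KR_pow_hierarchical_le]. *)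
Definition level_weight i : R :=
  if i is i'.+1 then (level_cost i'.+2 - level_cost i'.+1) / 2 else level_cost 1 / 2.

Lemma powR2_half : 2 `^ p / 2 = 2 `^ (p - 1) :> R.
Proof. by rewrite powRB ?powRr1 // pnatr_eq0 implybT. Qed.

Lemma level_weight_ge0 i : 0 <= level_weight i.
Proof.
case: i => [|i] /=; first by rewrite divr_ge0 ?powR_ge0.
rewrite divr_ge0 // subr_ge0 /level_cost.
(* Above the root the natural subtraction stops at 0, and the two costs agree. *)
have [iL|Li] := ltnP i L; last first.
  by have -> : (L.+1 - i.+2 = L.+1 - i.+1)%N by lia.
have -> : (L.+1 - i.+1 = (L.+1 - i.+2).+1)%N by lia.
have h0 : 0 <= height d q L (L.+1 - i.+2).+1 by rewrite height_ge0 //; lia.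
have le_h : height d q L (L.+1 - i.+2).+1 <= height d q L (L.+1 - i.+2).
  by rewrite [leRHS]heightS lerDl mulr_ge0 ?powR_ge0 ?diam_ge0.
have h1 := le_trans h0 le_h.
by apply: ge0_ler_powR; rewrite ?nnegrE ?ler_pM2l // mulr_ge0.
Qed.

Lemma level_weight0 :
  level_weight 0 = diam d `^ p * 2 `^ (p - 1) * q `^ (- (L%:R * p)).
Proof.
rewrite /level_weight /level_cost subSS subn0 height_last.
rewrite !powRM ?mulr_ge0 ?powR_ge0 ?diam_ge0 // -powRrM -powR2_half mulNr; ring.
Qed.

(** In general the subtracted cost is dropped and [height_le] applies. For p = 1 the difference of
    two consecutive heights is exactly one radius, so no geometric factor appears. *)
Lemma level_weightS_le i : (i < L)%N ->
  level_weight i.+1 <=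
  diam d `^ p * 2 `^ (p - 1) * (c `^ p * q `^ (p - (L - i)%:R * p)).
Proof.
move=> iL; rewrite /= /level_cost.
have -> : (L.+1 - i.+1 = (L.+1 - i.+2).+1)%N by lia.
have -> : (L - i = (L.+1 - i.+2).+1)%N by lia.
have : (L.+1 - i.+2 <= L)%N by lia.
move: (L.+1 - i.+2)%N => k kL.
have -> : q `^ (p - k.+1%:R * p) = (q `^ (- k%:R)) `^ p.
  by rewrite -powRrM -natr1; congr (_ `^ _); ring.
case: c_spec => [->|[-> ->]].
  apply: (@le_trans _ _ ((2 * height d q L k) `^ p / 2)).
    by rewrite ler_pM2r // gerBl powR_ge0.
  have h0 : 0 <= height d q L k by rewrite height_ge0 // leqW.
  have e0 : 0 <= q / (q - 1) by rewrite divr_ge0 ?ltW.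
  have -> : (2 * height d q L k) `^ p / 2 = 2 `^ (p - 1) * height d q L k `^ p.
    by rewrite powRM // mulrAC powR2_half.
  have D0 : 0 <= diam d := diam_ge0.
  have w0 : 0 <= q `^ (- k%:R) := powR_ge0 _ _.
  have ew0 := mulr_ge0 e0 w0.
  rewrite [leRHS](_ : _ = 2 `^ (p - 1) * (q / (q - 1) * q `^ (- k%:R) * diam d) `^ p).
    rewrite ler_wpM2l ?powR_ge0 //; apply: ge0_ler_powR; last exact: height_le.
    - exact: p0.
    - by rewrite nnegrE.
    - by rewrite nnegrE (mulr_ge0 ew0).
  by rewrite (powRM _ ew0 D0) (powRM _ e0 w0); ring.
have h0 : 0 <= height d q L k.+1 by rewrite height_ge0.
have h1 : 0 <= height d q L k by rewrite height_ge0 // leqW.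
rewrite subrr powRr0 powR1 (powRr1 (mulr_ge0 (ler0n R 2) h0)).
rewrite (powRr1 (mulr_ge0 (ler0n R 2) h1)) (powRr1 diam_ge0) powRr1 ?powR_ge0 //.
by rewrite [height d q L k]heightS; lra.
Qed.

(** The default 0 of [head] is never taken: the least [k] with [2 * height d q L k <= C] is at most
    [L] because [C] is not small, is positive because [C < 2 * height d q L 0], and so passes the
    filter. *)
Lemma E_poi_mid : ~~ small_C d C q L -> C < 2 * height d q L 0 ->
  exists2 l, (0 < l <= L)%N /\ C < 2 * height d q L l.-1
    & E_poi d c p C q L = A_const d c q p L l.
Proof.
move=> C_big C_lt; rewrite /E_poi (negPf C_big) leNgt C_lt /=.
set l := level_index d C q L; exists l => //.
have LC : 2 * height d q L L <= C.
  by move: C_big; rewrite /small_C le_max negb_or -!ltNge => /andP[/ltW].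
pose P k := 2 * height d q L k <= C.
have [m Pm m_min] := ex_minnP (ex_intro P L LC).
have m0 : (0 < m)%N.
  by case: m Pm {m_min} => //; rewrite /P leNgt C_lt.
have mL : (m <= L)%N by exact: m_min.
set s := [seq l <- iota 1 L | (2 * height d q L l <= C) && (C < 2 * height d q L l.-1)].
have ms : m \in s.
  rewrite mem_filter mem_iota m0 add1n ltnS mL (Pm : 2 * height d q L m <= C) /= andbT ltNge.
  by apply/negP => /m_min; case: (m) m0 => // m' _; rewrite ltnn.
have : l \in s.
  by rewrite /l /level_index -/s; case: (s) ms => // a s' _; rewrite /= mem_head.
by rewrite mem_filter mem_iota => /andP[/andP[_ ->] /andP[-> /=]]; rewrite add1n ltnS => ->.
Qed.

(** Level 0 is compared with the term in |X|^(1/2), and level [i.+1] with scale j = L - i. *)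
Lemma sum_level_weight_le (Q : nat -> {set T}) l : (0 < l)%N -> (l <= L.+1)%N ->
  (forall i, (#|Q i.+1| <= cover_number d q (L - i))%N) ->
  \sum_(i < (L.+1 - l).+1) level_weight i * Num.sqrt #|Q i|%:R <= A_const d c q p L l.
Proof.
move=> l0 lL QN; rewrite /A_const mulrDr big_ord_recl; apply: lerD.
  rewrite level_weight0 -!mulrA !ler_wpM2l ?powR_ge0 // ler_wsqrtr // ler_nat.
  exact: max_card.
rewrite sum_nat_rev !mulr_sumr; apply: ler_sum => i _.
have iL : (i < L)%N by have := ltn_ord i; lia.
rewrite !mulrA -[X in X * Num.sqrt (cover_number _ _ _)%:R]mulrA.
apply: ler_pM; [exact: level_weight_ge0|exact: sqrtr_ge0|exact: level_weightS_le|].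
by apply: ler_wsqrtr; rewrite ler_nat; exact: QN.
Qed.

(** Separates geometry from probability: the same [kappa] bounds KR^p through the imbalances and
    stays below [E_poi] once these are replaced by |Q i|^(1/2). *)
Lemma KR_pow_tree_le : ~~ small_C d C q L ->
  exists (f : nat -> T -> T) (Q : nat -> {set T}) (kappa : nat -> R) (n : nat),
  [/\ forall i x, f i x \in Q i, forall i, 0 <= kappa i,
      \sum_(i < n) kappa i * Num.sqrt #|Q i|%:R <= E_poi d c p C q L
    & forall mu nu : T -> R, (forall x, 0 <= mu x) -> (forall x, 0 <= nu x) ->
      KR_pow d p C mu nu <= \sum_(i < n) kappa i * imbalance (f i) mu nu].
Proof.
move=> C_big; have [f [Q [f0 f_mono fQ QN df]]] := ex_tree.
have [d_ge0 d0 d_sym d_triangle] := d_metric.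
have dr n i x y : (n <= L.+1)%N -> (0 < i)%N -> (i <= n)%N -> f i x = f i y ->
    d x y `^ p <= level_cost i.
  move=> nL _ le_in fxy; have iL : (i <= L.+1)%N by exact: leq_trans nL.
  have h0 : 0 <= height d q L (L.+1 - i) by rewrite height_ge0 ?leq_subr.
  apply: ge0_ler_powR; rewrite ?nnegrE ?d_ge0 ?(mulr_ge0 _ h0) //.
  apply: le_trans (d_triangle _ (f i x) _) _.
  rewrite mulr_natl mulr2n lerD ?df // fxy d_sym df //.
have dxx x : d x x `^ p = 0.
  by rewrite (d0 x x).2 // powR0 // gt_eqF // (lt_le_trans _ p1).
have hier n mu nu := @KR_pow_hierarchical_le R T d p C f level_cost n mu nu.
have half_parts n (S : nat -> R) : (\sum_(i < n) level_cost i.+1 * (S i - S i.+1)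
    + level_cost n.+1 * S n) / 2 = \sum_(i < n.+1) level_weight i * S i.
  rewrite sum_by_parts big_ord_recl mulrDl mulrAC; congr (_ + _).
  by rewrite mulr_suml; apply: eq_bigr => i _; rewrite /= mulrAC.
have [C_top|C_lt] := leP (2 * height d q L 0) C; last first.
  have [l [/andP[l0 lL] Cl] ->] := E_poi_mid C_big C_lt.
  exists f, Q, level_weight, (L.+1 - l).+1; split => //.
  - exact: level_weight_ge0.
  - by apply: sum_level_weight_le => //; exact: leqW.
  move=> mu nu mu0 nu0.
  apply: le_trans (hier (L.+1 - l)%N _ _ mu0 nu0 f0 dxx f_mono (fun i x y => dr _ i x y (leq_subr _ _))) _.
  (* As [C < 2 * height d q L l.-1], the charge [C ^ p] on unmatched mass is at most the cost of the
     next level, with which the summation by parts closes. *)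
  rewrite -(half_parts (L.+1 - l)%N (fun i => imbalance (f i) mu nu)) ler_pM2r // lerD2l ler_wpM2r ?imbalance_ge0 //.
  rewrite /level_cost; have -> : (L.+1 - (L.+1 - l).+1 = l.-1)%N by lia.
  apply: ge0_ler_powR; rewrite // ?nnegrE ?(ltW C0) ?(ltW Cl) //.
  exact: ltW (lt_trans C0 Cl).
have cost_top : level_cost L.+1 <= C `^ p.
  rewrite /level_cost subnn.
  by apply: ge0_ler_powR; rewrite // ?nnegrE ?(ltW C0) // mulr_ge0 ?height_ge0.
(* Here matching goes up to the root, where unmatched mass pays [C ^ p]. The root level has at most
   one node, so its coefficient enters [E_poi] without a square root. *)
pose kappa i := if i == L.+1 then (C `^ p - level_cost L.+1) / 2 else level_weight i.
exists f, Q, kappa, L.+2; split => //.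
- move=> i; rewrite /kappa; case: ifP => _; last exact: level_weight_ge0.
  by rewrite divr_ge0 ?subr_ge0.
- rewrite /E_poi (negPf C_big) C_top big_ord_recr /= addrC; apply: lerD.
    have -> : C `^ p / 2 - 2 `^ (p - 1) * ((q - q `^ (- L%:R)) / (q - 1) * diam d) `^ p
        = kappa L.+1.
      rewrite /kappa eqxx [RHS]mulrBl; congr (_ - _); rewrite /level_cost subnn.
      rewrite [in RHS]powRM ?height_ge0 // [RHS]mulrAC powR2_half /height subr0 powRr1 //.
      exact: ltW.
    rewrite ler_piMr /kappa ?eqxx ?divr_ge0 ?subr_ge0 //.
    rewrite -[leRHS]sqrtr1 ler_wsqrtr // -[1]/(1%:R) ler_nat.
    by apply: leq_trans (QN L) _; rewrite subnn cover_number0.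
  rewrite (eq_bigr (fun i : 'I_L.+1 => level_weight i * Num.sqrt #|Q i|%:R)); last first.
    by move=> i _; rewrite /kappa ltn_eqF.
  by have := @sum_level_weight_le Q 1 isT isT QN; rewrite subSS subn0.
move=> mu nu mu0 nu0.
apply: le_trans (hier L.+1 _ _ mu0 nu0 f0 dxx f_mono (fun i x y => dr _ i x y (leqnn _))) _.
rewrite [leRHS]big_ord_recr /=.
rewrite [X in _ <= X + _](eq_bigr (fun i : 'I_L.+1 => level_weight i * imbalance (f i) mu nu)); last first.
  by move=> i _; rewrite /kappa ltn_eqF.
rewrite -(half_parts L (fun i => imbalance (f i) mu nu)) big_ord_recr /= /kappa eqxx.
by rewrite le_eqVlt; apply/orP; left; apply/eqP; field.
Qed.

End Bound.
End Tree.

(** * Expectation bounds *)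

Section Expectation.
Context {R : realType}.

(** Young's inequality for x^(1/p) and 1; p = 1 is separate because its conjugate exponent is
    infinite. *)
Lemma powR_inv_le_affine (p x : R) : 1 <= p -> 0 <= x -> x `^ p^-1 <= x / p + (1 - p^-1).
Proof.
move=> p1 x0; have p0 : 0 < p by exact: lt_le_trans p1.
move: p1; rewrite le_eqVlt => /predU1P[<-|p1].
  by rewrite invr1 powRr1 // mulr1 subrr addr0.
have B0 : 0 < 1 - p^-1 by rewrite subr_gt0 invf_lt1.
have := @conjugate_powR R (x `^ p^-1) 1 p (1 - p^-1)^-1 (powR_ge0 _ _) ler01 p0.
rewrite invr_gt0 invrK [p^-1 + _]addrC subrK => /(_ B0 erefl).
by rewrite mulr1 -powRrM mulVf ?gt_eqF // powRr1 // powR1 mul1r.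
Qed.

(* The concave map x |-> x^(1/p) lies below its tangent at B. *)
Lemma jensen_powR_inv (I : finType) (W c : I -> R) (p B : R) :
  1 <= p -> 0 < B -> (forall i, 0 <= W i) -> (forall i, 0 <= c i) ->
  \sum_i W i <= 1 -> \sum_i W i * c i <= B ->
  \sum_i W i * c i `^ p^-1 <= B `^ p^-1.
Proof.
move=> p1 B0 W0 c0 W1 WB; have p0 : 0 < p by exact: lt_le_trans p1.
have a0 : 0 <= 1 - p^-1 by rewrite subr_ge0 invf_le1.
apply: (@le_trans _ _ (\sum_i W i * (B `^ p^-1 * (c i / B / p + (1 - p^-1))))).
  apply: ler_sum => i _; rewrite ler_wpM2l //.
  have cB0 : 0 <= c i / B by rewrite divr_ge0 // ltW.
  rewrite -[X in X `^ _ <= _](divfK (lt0r_neq0 B0)) powRM ?(ltW B0) // mulrC.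
  by rewrite ler_wpM2l ?powR_ge0 ?powR_inv_le_affine.
have -> : \sum_i W i * (B `^ p^-1 * (c i / B / p + (1 - p^-1))) =
    B `^ p^-1 * ((\sum_i W i * c i) / B / p + (\sum_i W i) * (1 - p^-1)).
  rewrite !mulr_suml -big_split mulr_sumr /=; apply: eq_bigr => i _.
  by field; rewrite !gt_eqF.
rewrite ler_piMr ?powR_ge0 //.
apply: (@le_trans _ _ (p^-1 + 1 * (1 - p^-1))); last by rewrite mul1r addrC subrK.
apply: lerD; last by rewrite ler_wpM2r.
by rewrite ler_piMl ?invr_ge0 ?(ltW p0) // ler_pdivrMr // mul1r.
Qed.

End Expectation.

(** * From boxes of counts to the Poisson model *)

Section Model.
Context {R : realType} {T : finType}.
Variables (mu : T -> R) (t s : R).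
Hypotheses (mu0 : forall x, 0 <= mu x) (t0 : 0 < t) (s01 : 0 < s <= 1).

Definition outcome N (w : {ffun T -> 'I_N * bool}) : {ffun T -> nat} * {ffun T -> bool} :=
  ([ffun x => (w x).1 : nat], [ffun x => (w x).2]).

Lemma poisson_model_weight_outcome N (w : {ffun T -> 'I_N * bool}) :
  poisson_model_weight mu t s (outcome w) = prod_weight (box_pmf mu t s) w.
Proof. by apply: eq_bigr => x _; rewrite !ffunE. Qed.

Lemma poisson_estimator_outcome N (w : {ffun T -> 'I_N * bool}) x :
  poisson_estimator t s (outcome w) x - mu x = box_dev mu t s x (w x).
Proof. by rewrite /poisson_estimator /box_dev !ffunE. Qed.

Lemma poisson_model_weight_ge0 w : 0 <= poisson_model_weight mu t s w.
Proof.
case/andP: s01 => s0 s1; apply: prodr_ge0 => x _.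
rewrite mulr_ge0 ?poi_pmf_ge0 ?mulr_ge0 ?(ltW t0) //.
by rewrite /ber_pmf; case: ifP; rewrite ?subr_ge0 // ltW.
Qed.

Lemma poisson_estimator_ge0 (w : {ffun T -> nat} * {ffun T -> bool}) x : 0 <= poisson_estimator t s w x.
Proof.
by case/andP: s01 => s0 _; rewrite !mulr_ge0 ?invr_ge0 ?mulr_ge0 ?ler0n ?ltW.
Qed.

(** The sum is the supremum of its finite partial sums, and a finite set of outcomes lies in every
    box beyond its largest count; the other terms of the box are nonnegative. *)
Lemma esum_poisson_model_le (h : {ffun T -> nat} * {ffun T -> bool} -> R) (B : R) :
  (forall w, 0 <= h w) ->
  (exists N0, forall N, (N0 <= N)%N ->
     \sum_(w : {ffun T -> 'I_N * bool}) prod_weight (box_pmf mu t s) w * h (outcome w) <= B) ->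
  (\esum_(w in [set: {ffun T -> nat} * {ffun T -> bool}]) (poisson_model_weight mu t s w * h w)%:E
     <= B%:E)%E.
Proof.
move=> h0 [N0 box_le]; apply: ge_ereal_sup => _ /= [A [A_fin _] <-].
rewrite fsbig_finite // sumEFin lee_fin.
move: (finmap.fset_uniq (fset_set A)); move: (finmap.enum_fset _) => r r_uniq.
pose M := \max_(w <- r) \max_x w.1 x.
pose N := maxn N0 M.
apply: le_trans (box_le N.+1 _); last by rewrite leqW // leq_maxl.
pose psi (w : {ffun T -> nat} * {ffun T -> bool}) : {ffun T -> 'I_N.+1 * bool} :=
  [ffun x => (inord (w.1 x), w.2 x)].
have psiK : {in r, cancel psi (@outcome N.+1)}.
  move=> w wr; rewrite [RHS]surjective_pairing; congr pair; apply/ffunP => x; rewrite !ffunE //=.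
  rewrite inordK // ltnS; apply: leq_trans (leq_maxr _ _).
  apply: leq_trans (leq_bigmax_seq _ wr _) => //.
  exact: leq_bigmax.
pose F (w : {ffun T -> 'I_N.+1 * bool}) := prod_weight (box_pmf mu t s) w * h (outcome w).
have F0 w : 0 <= F w.
  by rewrite mulr_ge0 // -poisson_model_weight_outcome poisson_model_weight_ge0.
have -> : \sum_(w <- r) poisson_model_weight mu t s w * h w = \sum_(w <- map psi r) F w.
  rewrite big_map big_seq [RHS]big_seq; apply: eq_bigr => w wr.
  by rewrite /F -poisson_model_weight_outcome psiK.
rewrite big_uniq /=; last by rewrite (map_inj_in_uniq (can_in_inj psiK)).
by rewrite [leRHS](bigID (mem (map psi r))) /= lerDl; apply: sumr_ge0 => w _; exact: F0.
Qed.

(* Young's inequality is used at B + e because it needs a positive bound; the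
   slack e also absorbs the bias of the truncation. *)
Lemma expected_KR_poisson_le (d : T -> T -> R) p C B : 1 <= p -> 0 <= B ->
  (forall e, 0 < e -> exists N0, forall N, (N0 <= N)%N ->
     \sum_(w : {ffun T -> 'I_N * bool}) prod_weight (box_pmf mu t s) w *
        KR_pow d p C (poisson_estimator t s (outcome w)) mu <= B + e) ->
  (expected_KR_poisson d p C mu t s <= (B `^ p^-1)%:E)%E.
Proof.
move=> p1 B0 box_le; have p0 : 0 < p by exact: lt_le_trans p1.
have KR0 w : 0 <= KR_pow d p C (poisson_estimator t s w) mu.
  by apply: KR_pow_ge0 => // x; exact: poisson_estimator_ge0.
have E_le e : 0 < e -> (expected_KR_poisson d p C mu t s <= ((B + e) `^ p^-1)%:E)%E.
  move=> e0; apply: esum_poisson_model_le => [w|]; first exact: powR_ge0.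
  have [N0 {}box_le] := box_le e e0; exists N0 => N leN.
  have g0 x (j : 'I_N * bool) : 0 <= box_pmf mu t s x j by exact: box_pmf_ge0.
  apply: jensen_powR_inv => //.
  - by rewrite ltr_wpDl.
  - by move=> w; exact: prod_weight_ge0.
  - by move=> w; exact: KR0.
  - by apply: sum_prod_weight_le1 => // x; exact: box_pmf_sum_le1.
  - exact: box_le.
have E0 : (0 <= expected_KR_poisson d p C mu t s)%E.
  by apply: esum_ge0 => w _; rewrite lee_fin mulr_ge0 ?poisson_model_weight_ge0 ?powR_ge0.
(* The case e = 1 gives finiteness. Raising to the power p then makes the slack additive, so it can
   be removed without continuity of the root. *)
have := E_le 1 ltr01; move: E0 E_le.
case: (expected_KR_poisson d p C mu t s) => [z| |] //; rewrite lee_fin => z0 E_le _.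
rewrite lee_fin -(powRr1 z0) -(mulfV (lt0r_neq0 p0)) powRrM.
apply: ge0_ler_powR; rewrite ?nnegrE ?powR_ge0 ?invr_ge0 ?(ltW p0) //.
apply/ler_addgt0Pr => e e0.
have Be0 : 0 <= B + e by rewrite addr_ge0 // ltW.
rewrite -[leRHS](powRr1 Be0) -(mulVf (lt0r_neq0 p0)) powRrM.
by apply: ge0_ler_powR; rewrite ?nnegrE ?powR_ge0 ?(ltW p0) // -lee_fin E_le.
Qed.

(** Only the diagonal is matched ([n = 0]), so KR^p is at most [C ^ p / 2] times the L1 distance,
    averaged coordinate by coordinate. *)
Lemma box_KR_pow_small_le (d : T -> T -> R) p C N :
  is_metric d -> 1 <= p ->
  \sum_(w : {ffun T -> 'I_N * bool}) prod_weight (box_pmf mu t s) w *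
     KR_pow d p C (poisson_estimator t s (outcome w)) mu <=
  C `^ p / 2 * (2 * (1 - s) * mass mu + s / Num.sqrt t * \sum_x Num.sqrt (mu x)).
Proof.
move=> [_ d0 _ _] p1.
have g0 x (j : 'I_N * bool) : 0 <= box_pmf mu t s x j by exact: box_pmf_ge0.
have dxx x : d x x `^ p = 0.
  by rewrite (d0 x x).2 // powR0 // gt_eqF // (lt_le_trans _ p1).
have KR_le (w : {ffun T -> 'I_N * bool}) : KR_pow d p C (poisson_estimator t s (outcome w)) mu <=
    C `^ p / 2 * \sum_x `|box_dev mu t s x (w x)|.
  have := @KR_pow_hierarchical_le R T d p C (fun=> id) (fun=> 0) 0
    (poisson_estimator t s (@outcome N w)) mu.
  move=> /(_ (poisson_estimator_ge0 _) mu0 (@inj_id T) dxx); rewrite big_ord0 add0r mulrAC.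
  have -> : imbalance id (poisson_estimator t s (outcome w)) mu =
      \sum_x `|box_dev mu t s x (w x)|.
    by apply: eq_bigr => x _; rewrite big_pred1_eq poisson_estimator_outcome.
  by apply=> // -[].
apply: (@le_trans _ _ (\sum_(w : {ffun T -> 'I_N * bool}) \sum_x
    C `^ p / 2 * (prod_weight (box_pmf mu t s) w * `|box_dev mu t s x (w x)|))).
  apply: ler_sum => w _; rewrite -mulr_sumr -mulr_sumr mulrCA.
  by rewrite ler_wpM2l ?prod_weight_ge0.
rewrite exchange_big /= /mass !mulr_sumr -big_split mulr_sumr /=; apply: ler_sum => x _.
rewrite -mulr_sumr ler_wpM2l ?divr_ge0 ?powR_ge0 //.
apply: le_trans (box_abs_dev_le N mu0 t0 s01 x).
apply: (prod_weight_marginal_le x (f := fun j => `|box_dev mu t s x j|)) => // y.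
exact: box_pmf_sum_le1.
Qed.

Definition box_bias N : R := \sum_x `|\sum_(j : 'I_N * bool) box_pmf mu t s x j * box_dev mu t s x j|.

Lemma cvg_box_bias_sum : (box_bias N @[N --> \oo] --> (0 : R))%classic.
Proof.
suff : (box_bias N @[N --> \oo] --> \sum_(x : T) `|0 : R|)%classic.
  by rewrite normr0 big1.
apply: cvg_big => [|x _]; first exact: add_continuous.
by apply: cvg_norm; exact: cvg_box_bias.
Qed.

Lemma box_imbalance_le N (f : T -> T) (Q : {set T}) : (forall x, f x \in Q) ->
  \sum_(w : {ffun T -> 'I_N * bool}) prod_weight (box_pmf mu t s) w *
     imbalance f (poisson_estimator t s (outcome w)) mu <=
  Num.sqrt #|Q|%:R *
  (Num.sqrt ((s * t)^-1 * mass mu + (1 - s) / s * \sum_x mu x ^+ 2) + box_bias N).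
Proof.
move=> fQ; set V := (s * t)^-1 * mass mu + _.
have g0 x (j : 'I_N * bool) : 0 <= box_pmf mu t s x j by exact: box_pmf_ge0.
have g1 x : \sum_(j : 'I_N * bool) box_pmf mu t s x j <= 1 by exact: box_pmf_sum_le1.
have bias0 : 0 <= box_bias N by exact: sumr_ge0.
have le_V : \sum_x \sum_(j : 'I_N * bool) box_pmf mu t s x j * box_dev mu t s x j ^+ 2 <= V.
  rewrite /V /mass !mulr_sumr -big_split /=; apply: ler_sum => x _; exact: box_var_le.
have V0 : 0 <= V.
  apply: le_trans le_V; apply: sumr_ge0 => x _; apply: sumr_ge0 => j _.
  by rewrite mulr_ge0 ?sqr_ge0.
apply: (@le_trans _ _ (Num.sqrt #|Q|%:R * Num.sqrt (V + box_bias N ^+ 2))).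
  have le_V' := le_V; rewrite -(lerD2r (box_bias N ^+ 2)) in le_V'.
  apply: le_trans (ler_wpM2l (sqrtr_ge0 _) (ler_wsqrtr le_V')).
  apply: le_trans (prod_weight_partition_le (box_dev mu t s) g0 g1 fQ).
  apply: ler_sum => w _; rewrite ler_wpM2l ?prod_weight_ge0 //.
  apply: ler_sum => v _; rewrite le_eqVlt; apply/orP; left; apply/eqP; congr `|_|.
  by apply: eq_bigr => x _; rewrite poisson_estimator_outcome.
(* Comparing squares bounds the root of V + bias^2 by the root of V plus the bias. *)
rewrite ler_wpM2l ?sqrtr_ge0 // -[leRHS]ger0_norm ?addr_ge0 ?sqrtr_ge0 // -sqrtr_sqr.
rewrite ler_wsqrtr // sqrrD sqr_sqrtr // -[leRHS]addrA lerD2l lerDr.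
by rewrite mulrn_wge0 // mulr_ge0 ?sqrtr_ge0.
Qed.

Lemma expected_KR_poisson_le_bound (d : T -> T -> R) (p C q c : R) (L : nat) :
  is_metric d -> (1 < #|T|)%N -> 1 <= p -> 0 < C -> 1 < q ->
  c = q / (q - 1) \/ p = 1 /\ c = 1 ->
  (expected_KR_poisson d p C mu t s <= (poisson_bound d c p C q L mu t s)%:E)%E.
Proof.
move=> d_metric T2 p1 C0 q1 c_spec; rewrite /poisson_bound.
have [s0 s1] := andP s01.
have mass0 : 0 <= mass mu by exact: sumr_ge0.
have [C_small|C_big] := boolP (small_C d C q L).
  set B := 2 * (1 - s) * mass mu + _.
  have B0 : 0 <= B.
    rewrite addr_ge0 ?mulr_ge0 ?subr_ge0 ?invr_ge0 ?sqrtr_ge0 ?(ltW s0) //.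
    by apply: sumr_ge0 => x _; exact: sqrtr_ge0.
  rewrite /E_poi C_small -powRM ?divr_ge0 ?powR_ge0 //.
  apply: expected_KR_poisson_le => //; first by rewrite mulr_ge0 ?divr_ge0 ?powR_ge0.
  move=> e e0; exists 0%N => N _; apply: le_trans (box_KR_pow_small_le _ _ _ _) _ => //.
  by rewrite lerDl ltW.
set V := (s * t)^-1 * mass mu + _.
have V0 : 0 <= V.
  rewrite addr_ge0 ?mulr_ge0 ?invr_ge0 ?mulr_ge0 ?subr_ge0 ?(ltW s0) ?(ltW t0) //.
  by apply: sumr_ge0 => x _; exact: sqr_ge0.
have [f [Q [kappa [n [fQ kappa0 kappaE KR_le]]]]] :=
  KR_pow_tree_le d_metric T2 q1 p1 C0 c_spec C_big.
set E := E_poi d c p C q L in kappaE *.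
have E0 : 0 <= E.
  by apply: le_trans kappaE; apply: sumr_ge0 => i _; rewrite mulr_ge0 ?sqrtr_ge0.
have -> : V `^ (2 * p)^-1 = Num.sqrt V `^ p^-1.
  by rewrite -powR12_sqrt // -powRrM invfM.
rewrite -powRM ?sqrtr_ge0 //.
apply: expected_KR_poisson_le => //; first by rewrite mulr_ge0 ?sqrtr_ge0.
move=> e e0.
(* All levels share the factor [Num.sqrt V + box_bias N], so one threshold [N0] serves the whole
   tree. *)
have [N0 _ bias_le] : \forall N \near \oo%classic, E * box_bias N <= e.
  apply: (@cvgr_le _ _ _ _ _ 0) => //.
  suff : (E * box_bias N @[N --> \oo] --> E * 0)%classic by rewrite mulr0.
  by apply: cvgMr; exact: cvg_box_bias_sum.
exists N0 => N leN; apply: le_trans (lerD (lexx _) (bias_le N leN)).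
rewrite -mulrDr.
apply: (@le_trans _ _ (\sum_(w : {ffun T -> 'I_N * bool}) \sum_(i < n)
   kappa i * (prod_weight (box_pmf mu t s) w *
              imbalance (f i) (poisson_estimator t s (outcome w)) mu))).
  apply: ler_sum => w _.
  apply: (@le_trans _ _ (prod_weight (box_pmf mu t s) w *
     \sum_(i < n) kappa i * imbalance (f i) (poisson_estimator t s (outcome w)) mu)).
    rewrite ler_wpM2l ?KR_le //; last exact: poisson_estimator_ge0.
    by apply: prod_weight_ge0 => x j; exact: box_pmf_ge0.
  by rewrite mulr_sumr; apply: ler_sum => i _; rewrite mulrCA.
rewrite exchange_big /=.
apply: (@le_trans _ _ ((\sum_(i < n) kappa i * Num.sqrt #|Q i|%:R)
                        * (Num.sqrt V + box_bias N))).
  rewrite mulr_suml; apply: ler_sum => i _.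
  by rewrite -mulr_sumr -mulrA ler_wpM2l ?box_imbalance_le.
by rewrite ler_wpM2r // addr_ge0 ?sqrtr_ge0 // sumr_ge0.
Qed.

End Model.

Theorem theorem2p2 (R : realType) (T : finType) (d : T -> T -> R)
  (mu : T -> R) (t s : R) :
  is_metric d -> (1 < #|T|)%N ->
  (forall x, 0 <= mu x) -> 0 < t -> 0 < s <= 1 ->
  forall (p C q : R) (L : nat), 1 <= p -> 0 < C -> 1 < q ->
    (expected_KR_poisson d p C mu t s
       <= (poisson_bound d (q / (q - 1)) p C q L mu t s)%:E)%E
    /\ (p = 1 ->
        (expected_KR_poisson d p C mu t s
           <= (poisson_bound d 1 p C q L mu t s)%:E)%E).
Proof.
move=> d_metric T2 mu0 t0 s01 p C q L p1 C0 q1; split => [|p_eq1].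
  by apply: expected_KR_poisson_le_bound => //; left.
by apply: expected_KR_poisson_le_bound => //; right.
Qed.
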